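(* Let $G=(X,Y,E)$ be a connected convex bipartite graph with $Y=\{y_1<\dots<y_{n_Y}\}$ in convex order and $X=\{x_1<\dots<x_{n_X}\}$ in lex-convex order, let $Label$ be the array produced by the labelling procedure described in the context, and let $k-1=\min_{x\in N(y_{n_Y})}Label[x]$. Then the enumeration procedure described in the context outputs exactly all minimum cardinality red dominating sets of $G$ (each of them), using linear space and with linear delay between consecutive outputs.
   Context: A bipartite graph $G=(X,Y,E)$ is convex if $Y$ can be ordered $y_1<\dots<y_{n_Y}$ so that each $N(x)$, $x\in X$, is a set of consecutive vertices; write $left(x)$, $right(x)$ for its smallest and largest neighbour, and identify $y_i$ with index $i$ (so $right(x)+1$ is the next vertex after $right(x)$). The order $x_1<\dots<x_{n_X}$ of $X$ is lex-convex if $i<j$ implies $left(x_i)<left(x_j)$, or $left(x_i)=left(x_j)$ and $right(x_i)\le right(x_j)$. A red dominating set is $D\subseteq X$ such that every $y\in Y$ has a neighbour in $D$; an MCRD set is one of minimum cardinality. Labelling procedure: set $Label[x]=\infty$, $Count[x]=0$ for all $x\in X$. Enqueue the neighbours of $y_1$ in increasing order into a FIFO queue and set their $Label$ to $0$ and $Count$ to $1$. While the queue is nonempty: dequeue $x$; for every $x_j$ with $x_j>x$, $left(x)<left(x_j)\le right(x)+1\le right(x_j)$ and $Label[x_j]\ge Label[x]+1$: if $Label[x_j]>Label[x]+1$ enqueue $x_j$ (if not already in the queue); set $Label[x_j]\leftarrow Label[x]+1$; set $Count[x_j]\leftarrow Count[x_j]+Count[x]$. Enumeration procedure: for every $x\in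 N(y_{n_Y})$ with $Label[x]=k-1$, call GENERATE$(\{x\},x)$. GENERATE$(D,x)$: if $Label[x]=0$, output $D$ and return; otherwise, for every $x_j<x$ with $left(x_j)\le left(x)-1\le right(x_j)<right(x)$ and $Label[x_j]=Label[x]-1$, call GENERATE$(D\cup\{x_j\},x_j)$. *)

(* Defs.v *)
From mathcomp Require Import all_boot.

Set Implicit Arguments.
Unset Strict Implicit.
Unset Printing Implicit Defensive.

(* A bipartite graph (X, Y, E) whose two sides come with a linear order:
   X = 'I_nX and Y = 'I_nY, the orders being those of the ordinals. *)
Definition bigraph (nX nY : nat) := 'I_nX -> 'I_nY -> bool.

Definition adj nX nY (E : bigraph nX nY) : rel ('I_nX + 'I_nY) :=
  fun u v => match u, v with
             | inl x, inr y => E x y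
             | inr y, inl x => E x y
             | _, _ => false
             end.

Definition connected nX nY (E : bigraph nX nY) : Prop :=
  forall u v : 'I_nX + 'I_nY, connect (adj E) u v.

Definition convex nX nY (E : bigraph nX nY) : Prop :=
  forall (x : 'I_nX) (y1 y y2 : 'I_nY),
    E x y1 -> E x y2 -> y1 <= y <= y2 -> E x y.

(* Vertices of Y are named by their index in 1, ..., nY, so the ordinal y is
   the vertex number y.+1, and left and right neighbours are such indices.
   Both values are meaningful when x has a neighbour. *)
Definition leftY nX nY (E : bigraph nX nY) (x : 'I_nX) : nat :=
  \big[minn/nY]_(y < nY | E x y) y.+1.

Definition rightY nX nY (E : bigraph nX nY) (x : 'I_nX) : nat :=
  \max_(y < nY | E x y) y.+1.

(* Neighbours, in increasing order, of the vertex number i of Y; the list is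
   empty when i is not in 1, ..., nY. *)
Definition nbrsY nX nY (E : bigraph nX nY) (i : nat) : seq 'I_nX :=
  [seq x <- enum 'I_nX | [exists y : 'I_nY, (y.+1 == i) && E x y]].

Definition lex_convex nX nY (E : bigraph nX nY) : Prop :=
  forall i j : 'I_nX, i < j ->
    leftY E i < leftY E j \/
    leftY E i = leftY E j /\ rightY E i <= rightY E j.

Definition red_dominating nX nY (E : bigraph nX nY) (D : {set 'I_nX}) : Prop :=
  forall y : 'I_nY, exists2 x, x \in D & E x y.

Definition MCRD nX nY (E : bigraph nX nY) (D : {set 'I_nX}) : Prop :=
  red_dominating E D /\
  forall D' : {set 'I_nX}, red_dominating E D' -> #|D| <= #|D'|.

(* Labels are natural numbers extended with an infinite value None. *)
Definition label := option nat.

Definition lab_le (a b : label) : bool :=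
  match a, b with
  | _, None => true
  | None, Some _ => false
  | Some m, Some n => m <= n
  end.
Definition lab_lt (a b : label) : bool := ~~ lab_le b a.
Definition lab_min (a b : label) : label := if lab_le a b then a else b.
Definition lab_succ (a : label) : label := omap succn a.
Definition lab_pred (a : label) : label := omap predn a.

Record lab_state (nX : nat) := LabState {
  Label : {ffun 'I_nX -> label};
  Count : {ffun 'I_nX -> nat};
  queue : seq 'I_nX
}.

Definition lab_init nX nY (E : bigraph nX nY) : lab_state nX :=
  LabState [ffun x => if x \in nbrsY E 1 then Some 0 else None]
           [ffun x => if x \in nbrsY E 1 then 1 else 0]
           (nbrsY E 1).

(* Body of the inner loop: x has just been dequeued and xj is examined. *)
Definition lab_visit nX nY (E : bigraph nX nY) (x : 'I_nX)
    (s : lab_state nX) (xj : 'I_nX) : lab_state nX :=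
  let lx1 := lab_succ (Label s x) in
  if [&& x < xj, leftY E x < leftY E xj,
         leftY E xj <= rightY E x + 1 <= rightY E xj
       & lab_le lx1 (Label s xj)]
  then LabState
         [ffun z => if z == xj then lx1 else Label s z]
         [ffun z => if z == xj then Count s xj + Count s x else Count s z]
         (if lab_lt lx1 (Label s xj) && (xj \notin queue s)
          then rcons (queue s) xj else queue s)
  else s.

(* One iteration of the while loop; idle when the queue is empty. *)
Definition lab_iter nX nY (E : bigraph nX nY) (s : lab_state nX) :
    lab_state nX :=
  if queue s is x :: q
  then foldl (lab_visit E x) (LabState (Label s) (Count s) q) (enum 'I_nX)
  else s.

Definition labelling_ends_in nX nY (E : bigraph nX nY) (s : lab_state nX) :
    Prop :=
  queue s = [::] /\ exists n : nat, s = iter n (lab_iter E) (lab_init E).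

(* The number k - 1. *)
Definition last_label nX nY (E : bigraph nX nY)
    (L : {ffun 'I_nX -> label}) : label :=
  \big[lab_min/None]_(x <- nbrsY E nY) L x.

(* The enumeration procedure is run on a unit-cost machine, each transition
   being a bounded number of elementary operations.
   - [todo] is the position reached by the main loop in the list N(y_nY).
   - [calls] is the recursion stack, innermost call first: an entry (x, i) is
     a pending call GENERATE(D, x) whose loop has reached position i in its
     list of candidates.
   - [dom] is the set D of the innermost call, kept on a single stack: entering
     GENERATE(D U {xj}, xj) pushes xj, and returning from it pops xj.
   A candidate xj must satisfy left(xj) <= left(x) - 1 <= right(xj), so that
   the loop of GENERATE runs through the list N(y_(left(x) - 1)). *)
Inductive control :=
  | Enter            (* first line of the innermost call *)
  | Loop             (* looking for the next candidate *)
  | Print of nat     (* writing D, one vertex at a time *)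
  | Return
  | Halt.

Record enum_state (nX : nat) := EnumState {
  ctl : control;
  todo : nat;
  calls : seq ('I_nX * nat);
  dom : seq 'I_nX
}.

Definition candidate nX nY (E : bigraph nX nY) (L : {ffun 'I_nX -> label})
    (x xj : 'I_nX) : bool :=
  [&& xj < x, leftY E xj <= leftY E x - 1 <= rightY E xj,
      rightY E xj < rightY E x & L xj == lab_pred (L x)].

Definition enum_init (nX : nat) : enum_state nX := EnumState Loop 0 [::] [::].

Definition enum_step nX nY (E : bigraph nX nY) (L : {ffun 'I_nX -> label})
    (k1 : label) (s : enum_state nX) : enum_state nX :=
  let: EnumState c p st D := s in
  match c with
  | Loop =>
      match st with
      | [::] =>
          match onth (nbrsY E nY) p with
          | Some x => if L x == k1
                      then EnumState Enter p.+1 [:: (x, 0)] [:: x]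
                      else EnumState Loop p.+1 [::] D
          | None => EnumState Halt p st D
          end
      | (x, i) :: st' =>
          match onth (nbrsY E (leftY E x - 1)) i with
          | Some xj => if candidate E L x xj
                       then EnumState Enter p
                              ((xj, 0) :: (x, i.+1) :: st') (xj :: D)
                       else EnumState Loop p ((x, i.+1) :: st') D
          | None => EnumState Return p st D
          end
      end
  | Enter =>
      if st is (x, _) :: _
      then if L x == Some 0 then EnumState (Print 0) p st D
           else EnumState Loop p st D
      else EnumState Halt p st D
  | Print i => if i < size D then EnumState (Print i.+1) p st D
               else EnumState Return p st D
  | Return => EnumState Loop p (behead st) (behead D)
  | Halt => s
  end.

Definition enum_run nX nY (E : bigraph nX nY) (L : {ffun 'I_nX -> label})
    (k1 : label) (t : nat) : enum_state nX :=
  iter t (enum_step E L k1) (enum_init nX).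

Definition halted nX (s : enum_state nX) : bool :=
  if ctl s is Halt then true else false.

(* D is output at the instant when its last vertex has been written. *)
Definition outputting nX (s : enum_state nX) : bool :=
  if ctl s is Print i then i == size (dom s) else false.

Definition output_times nX nY (E : bigraph nX nY) (L : {ffun 'I_nX -> label})
    (k1 : label) (T : nat) : seq nat :=
  [seq t <- iota 0 T | outputting (enum_run E L k1 t)].

Definition outputs nX nY (E : bigraph nX nY) (L : {ffun 'I_nX -> label})
    (k1 : label) (T : nat) : seq {set 'I_nX} :=
  [seq [set x in dom (enum_run E L k1 t)] | t <- output_times E L k1 T].

Definition edges nX nY (E : bigraph nX nY) : nat :=
  #|[set p : 'I_nX * 'I_nY | E p.1 p.2]|.

(* |V| + |E|, the size with respect to which bounds are linear. *)
Definition gsize nX nY (E : bigraph nX nY) : nat := nX + nY + edges E.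

(* Memory words in use: the adjacency lists of Y, the arrays left, right and
   Label, the recursion stack, the set D, and four registers (control point,
   printing position, main loop position, k - 1). Every word holds a number
   that is at most linear in the size of the graph. *)
Definition space nX nY (E : bigraph nX nY) (s : enum_state nX) : nat :=
  nY + edges E + 3 * nX + 2 * size (calls s) + size (dom s) + 4.

(* At most b steps separate consecutive outputs; the start (time 0) and the
   end (time T) of the run count as outputs here, as usual for the delay. *)
Definition delay_le (ts : seq nat) (T b : nat) : Prop :=
  path (fun t t' => t' - t <= b) 0 (rcons ts T).

(* Main.v *)
Require Import Defs.
From mathcomp Require Import all_boot.
From mathcomp Require Import zify.

(* Write x -> x' when x' may follow x in the labelling procedure: the interval
   of x' starts strictly to the right of that of x, ends strictly to the right
   of it, and leaves no gap. Every red dominating set contains a path for this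
   relation from N(y_1) to N(y_nY), and the vertices of such a path dominate, so
   the MCRD sets are exactly the vertex sets of shortest such paths, and labels
   are distances from N(y_1). Hence the i-th vertex of a shortest path carries
   label i, and GENERATE lists each of them once, from its last vertex back.
   Every vertex of positive label has a predecessor carrying the preceding
   label, so that no call is fruitless; and left strictly decreases along the
   recursion stack, so that the lists N(left(x) - 1) scanned on one descent, or
   on one ascent, are distinct and have total length at most |E|. *)

Set Implicit Arguments.
Unset Strict Implicit.
Unset Printing Implicit Defensive.

(** * Neighbourhoods as intervals of indices *)

Section Intervals.

Variables (nX nY : nat) (E : bigraph nX nY).
Implicit Types (x : 'I_nX) (y : 'I_nY).

Lemma leftY_le x y : E x y -> leftY E x <= y.+1.
Proof.
rewrite /leftY => Exy; rewrite -big_filter.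
have: y \in [seq y <- index_enum 'I_nY | E x y] by rewrite mem_filter Exy mem_index_enum.
elim: [seq _ <- _ | _] => //= z s IHs; rewrite inE big_cons => /predU1P[->|/IHs]; lia.
Qed.

Lemma leftY_attained x y :
  E x y -> exists2 z : 'I_nY, E x z & leftY E x = z.+1.
Proof.
(* The default [nY] of the minimum need not come from a neighbour; if the minimum equals [nY], then
   [y] is the last vertex and is itself the witness. *)
move=> Exy; have: leftY E x < nY \/ leftY E x = nY.
  by have := leftY_le Exy; have := ltn_ord y; lia.
case=> [|lY].
  rewrite /leftY; elim/big_ind: _ => [|a b IHa IHb|z Exz _]; first by lia.
    by rewrite /minn; case: ifP.
  by exists z.
by exists y => //; have := leftY_le Exy; have := ltn_ord y; lia.
Qed.

Lemma rightY_ge x y : E x y -> y.+1 <= rightY E x.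
Proof. by move=> Exy; exact: (@leq_bigmax_cond _ _ (fun z : 'I_nY => z.+1)). Qed.

Lemma rightY_attained x y :
  E x y -> exists2 z : 'I_nY, E x z & rightY E x = z.+1.
Proof.
move=> Exy; have P0 : 0 < #|[pred z | E x z]| by apply/card_gt0P; exists y.
by have [z Exz rE] := eq_bigmax_cond (fun z : 'I_nY => z.+1) P0; exists z.
Qed.

Lemma nbrsY_edge x y : (x \in nbrsY E y.+1) = E x y.
Proof.
rewrite mem_filter mem_enum inE andbT; apply/existsP/idP => [[z /andP[/eqP[zy]]]|Exy].
  by have -> : z = y by apply/val_inj.
by exists y; rewrite eqxx.
Qed.

Hypotheses (E_convex : convex E) (E_nonempty : forall x, exists y, E x y).

Lemma leftY_gt0 x : 0 < leftY E x.
Proof. by have [y /leftY_attained[z _ ->]] := E_nonempty x. Qed.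

Lemma leftY_le_rightY x : leftY E x <= rightY E x.
Proof. by have [y Exy] := E_nonempty x; have := leftY_le Exy; have := rightY_ge Exy; lia. Qed.

Lemma rightY_le x : rightY E x <= nY.
Proof. by have [y /rightY_attained[z _ ->]] := E_nonempty x; exact: ltn_ord. Qed.

(** Both ends are attained by neighbours, so convexity fills the interval between them. *)
Lemma mem_nbrsY x i : (x \in nbrsY E i) = (leftY E x <= i <= rightY E x).
Proof.
rewrite mem_filter mem_enum inE andbT; apply/existsP/idP.
  by case=> y /andP[/eqP<- Exy]; rewrite leftY_le // rightY_ge.
have [y Exy] := E_nonempty x.
have [z Exz ->] := leftY_attained Exy; have [t Ext ->] := rightY_attained Exy.
case: i => // i /andP[zi it]; have iY : i < nY by have := ltn_ord t; lia.
by exists (Ordinal iY); rewrite eqxx /=; apply: (E_convex Exz Ext); rewrite /=; lia.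
Qed.

End Intervals.

(** * The successor relation on [X] *)

Section Chains.

Variables (nX nY : nat) (E : bigraph nX nY).

(** The relation -> of the overview. Both procedures also ask for [x < y], which in a lex-convex
    order follows from the first inequality. *)
Definition succX (x y : 'I_nX) : bool :=
  [&& leftY E x < leftY E y, leftY E y <= (rightY E x).+1 & rightY E x < rightY E y].

Hypothesis E_lex : lex_convex E.

Implicit Types x y : 'I_nX.

Lemma leftY_ltn x y : leftY E x < leftY E y -> x < y.
Proof.
case: (ltngtP x y) => // [yx|/val_inj->]; last by rewrite ltnn.
by have := E_lex yx; lia.
Qed.

Lemma succX_ltn x y : succX x y -> x < y.
Proof. by case/andP=> /leftY_ltn. Qed.

End Chains.

(** * The labelling procedure: termination and correctness *)

Lemma lab_le_refl : reflexive lab_le. Proof. by case=> //= n; lia. Qed.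

Lemma lab_le_trans : transitive lab_le. Proof. by case=> [b|] [a|] [c|] //=; lia. Qed.

Section Labelling.

Variables (nX nY : nat) (E : bigraph nX nY).
Hypotheses (E_convex : convex E) (E_nonempty : forall x, exists y, E x y).
Hypothesis E_lex : lex_convex E.

Implicit Types (s : lab_state nX) (x z : 'I_nX).

(* Nothing here depends on the queue being FIFO: a vertex re-enters the queue
   whenever its label decreases, so labels are correct once the queue is empty. *)
Record lab_inv s : Prop := LabInv {
  lab_inv0 : forall x, (Label s x == Some 0) = (x \in nbrsY E 1);
  lab_invS : forall x n, Label s x = Some n.+1 ->
    exists2 z, succX E z x & lab_le (Label s z) (Some n);
  lab_inv_le : forall x n, Label s x = Some n -> n <= x }.

Lemma lab_visitE x z s : lab_visit E x s z =
  if succX E x z && lab_le (lab_succ (Label s x)) (Label s z)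
  then LabState
         [ffun t => if t == z then lab_succ (Label s x) else Label s t]
         [ffun t => if t == z then Count s z + Count s x else Count s t]
         (if lab_lt (lab_succ (Label s x)) (Label s z) && (z \notin queue s)
          then rcons (queue s) z else queue s)
  else s.
Proof.
rewrite /lab_visit; congr (if _ then _ else _); rewrite /succX addn1.
case: ltnP => //= xz; first by case: lab_le; rewrite ?andbF ?andbT //; lia.
by case: ltnP => // /(leftY_ltn E_lex); lia.
Qed.

(** A label 0 is never overwritten, as the new label is a successor. The relabelled vertex has [x]
    as predecessor; the others keep theirs, since only an upper bound on its label is asked and
    labels go down. *)
Lemma lab_visit_inv x z s : lab_inv s -> lab_inv (lab_visit E x s z).
Proof.
case=> s0 sS sle; rewrite lab_visitE; case: ifP => [/andP[xz le_xz]|_] //.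
split=> /= t; first rewrite ffunE.
- have [->|_ //] := eqVneq t z.
  by rewrite -s0; case: (Label s x) (Label s z) le_xz => [a|] [[|b]|].
- move=> n; rewrite ffunE; case: eqP => [->|_].
    case Lx: (Label s x) => [m|] //= [<-]; exists x => //.
    by rewrite ffunE; case: eqP => [xz'|_];
      [have := succX_ltn E_lex xz; rewrite xz'; lia|rewrite Lx /=].
  move=> /sS[u ut le_u]; exists u => //; rewrite ffunE; case: eqP => // uz.
  by apply: lab_le_trans le_u; rewrite uz.
- move=> n; rewrite ffunE; case: eqP => [->|_]; last exact: sle.
  case Lx: (Label s x) => [m|] //= [<-].
  by have := sle _ _ Lx; have := succX_ltn E_lex xz; lia.
Qed.

Lemma lab_visit_le x z s t : lab_le (Label (lab_visit E x s z) t) (Label s t).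
Proof.
rewrite lab_visitE; case: ifP => [/andP[_ le_xz]|_] /=; rewrite ?lab_le_refl //.
by rewrite ffunE; case: eqP => [->|_] //; rewrite lab_le_refl.
Qed.

(** [succX] is irreflexive, so the label offered to the successors of [x] stays constant during the
    inner loop of [x]. *)
Lemma lab_visit_self x z s : Label (lab_visit E x s z) x = Label s x.
Proof.
rewrite lab_visitE; case: ifP => [/andP[xz _]|_] //=; rewrite ffunE.
by case: eqP => // xz'; have := succX_ltn E_lex xz; rewrite -xz'; lia.
Qed.

Lemma lab_visit_relax x z s : succX E x z ->
  lab_le (Label (lab_visit E x s z) z) (lab_succ (Label s x)).
Proof.
move=> xz; rewrite lab_visitE xz /=; case: ifP => /=.
  by rewrite ffunE eqxx lab_le_refl.
by case: (Label s z) (Label s x) => [a|] [b|] //=; lia.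
Qed.

Lemma lab_visit_queue x z s : {subset queue s <= queue (lab_visit E x s z)}.
Proof.
move=> t tq; rewrite lab_visitE; case: ifP => //= _; case: ifP => // _.
by rewrite mem_rcons inE tq orbT.
Qed.

(** A strict decrease leaves the vertex in the queue; in case of equality the assignment changes
    nothing. *)
Lemma lab_visit_changed x z s t :
  t \notin queue (lab_visit E x s z) -> Label (lab_visit E x s z) t = Label s t.
Proof.
rewrite lab_visitE; case: ifP => [/andP[_ le_xz]|_] //=; rewrite ffunE.
case: eqP => [->|] //; case: ifP => [_|]; first by rewrite mem_rcons inE eqxx.
move/negbT; rewrite negb_and negbK => /orP[|->] //.
by case: (Label s z) (Label s x) le_xz => [a|] [b|] //=; rewrite /lab_lt ?negbK //= => ? ? _;
  congr Some; lia.
Qed.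

(* A finite label is at most the index of its vertex, so nX exceeds them all. *)
Definition lab_value (a : label) : nat := odflt nX a.

Definition lab_measure s : nat := \sum_x lab_value (Label s x) + size (queue s).

(** An insertion into the queue adds 1, but comes with a strict decrease of a label. *)
Lemma lab_visit_measure x z s :
  lab_inv s -> lab_measure (lab_visit E x s z) <= lab_measure s.
Proof.
move=> inv_s; have inv_s' := @lab_visit_inv x z _ inv_s.
have val_le a b (t : 'I_nX) : lab_le a b ->
    (forall n, a = Some n -> n <= t) -> lab_value a <= lab_value b.
  case: a b => [a|] [b|] //= _ /(_ _ erefl); have := ltn_ord t; lia.
move: inv_s'; have := lab_visit_le x z s; rewrite /lab_measure.
rewrite lab_visitE; case: ifP => //= /andP[xz le_xz] le_s inv_s'.
rewrite (bigD1 z) //= [X in _ <= X + _](bigD1 z) //=.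
set A := \sum_(_ | _) _; set B := \sum_(_ | _) _.
have -> : A = B by apply: eq_bigr => t /negbTE tz; rewrite ffunE tz.
have := le_s z; rewrite !ffunE eqxx => le_z.
have sle n : lab_succ (Label s x) = Some n -> n <= z.
  by move=> Ls; apply: (lab_inv_le inv_s'); rewrite /= ffunE eqxx.
case: ifP => [/andP[lt_xz _]|_]; last by have := val_le _ _ z le_z sle; lia.
rewrite size_rcons; move: sle lt_xz; rewrite /lab_lt.
case: (Label s z) => [b|]; case: (lab_succ _) => [a|] //= /(_ _ erefl); have := ltn_ord z; lia.
Qed.

Lemma lab_visits_inv x zs s : lab_inv s ->
  let s' := foldl (lab_visit E x) s zs in
  [/\ lab_inv s', lab_measure s' <= lab_measure s,
      forall t, t \notin queue s' -> t \notin queue s /\ Label s' t = Label s t,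
      forall t, lab_le (Label s' t) (Label s t)
    & forall z, z \in zs -> succX E x z ->
        lab_le (Label s' z) (lab_succ (Label s x))].
Proof.
elim: zs s => [|z zs IHzs] s inv_s /=; first by split=> // t; exact: lab_le_refl.
have inv_s1 := @lab_visit_inv x z _ inv_s.
have [inv_s' meas Lq Lle Lsucc] := IHzs _ inv_s1.
split=> //.
- by apply: leq_trans meas _; exact: lab_visit_measure.
- move=> t /Lq[tq ->]; split; last exact: lab_visit_changed.
  by apply: contra tq; exact: lab_visit_queue.
- by move=> t; apply: lab_le_trans (lab_visit_le x z s t).
- move=> t; rewrite inE => /predU1P[->|tzs] xt.
    by apply: lab_le_trans (Lle z) _; exact: lab_visit_relax.
  by rewrite -(lab_visit_self x z s); exact: Lsucc.
Qed.

Definition lab_closed s : Prop := forall x z, x \notin queue s -> succX E x z ->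
  lab_le (Label s z) (lab_succ (Label s x)).

(** A vertex outside the new queue either has just been dequeued, and all its successors were
    visited, or was outside before and kept its label. *)
Lemma lab_iter_inv s : lab_inv s -> lab_closed s ->
  lab_inv (lab_iter E s) /\ lab_closed (lab_iter E s).
Proof.
rewrite /lab_iter; case: s => L C [|x q] //= inv_s clos_s.
have inv_s1 : lab_inv (LabState L C q) by case: inv_s.
have [inv_s' _ Lq Lle Lsucc] := @lab_visits_inv x (enum 'I_nX) _ inv_s1.
split=> // t z /Lq[/= tq ->] tz.
have [tx|tx] := eqVneq t x.
  by rewrite tx in tz *; apply: Lsucc => //; rewrite mem_enum.
apply: lab_le_trans (Lle z) _; apply: clos_s => //=.
by rewrite inE negb_or tx.
Qed.

Lemma lab_iter_measure s : lab_inv s -> queue s <> [::] ->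
  lab_measure (lab_iter E s) < lab_measure s.
Proof.
rewrite /lab_iter; case: s => L C [|x q] //= inv_s _.
have inv_s1 : lab_inv (LabState L C q) by case: inv_s.
have [_ meas _ _ _] := @lab_visits_inv x (enum 'I_nX) _ inv_s1.
by apply: leq_ltn_trans meas _; rewrite /lab_measure /= addnS.
Qed.

Lemma lab_init_inv : lab_inv (lab_init E) /\ lab_closed (lab_init E).
Proof.
split; first by split=> [x|x n|x n] /=; rewrite ffunE; case: ifP => // _ [<-].
by move=> x z /= xq _; rewrite [X in lab_succ X]ffunE (negbTE xq); case: ([ffun _ => _] z).
Qed.

Lemma lab_iters_inv n :
  lab_inv (iter n (lab_iter E) (lab_init E)) /\
  lab_closed (iter n (lab_iter E) (lab_init E)).
Proof.
elim: n => [|n [IH1 IH2]]; first exact: lab_init_inv.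
exact: lab_iter_inv.
Qed.

Lemma labelling_terminates : exists s, labelling_ends_in E s.
Proof.
suff [n qn] : exists n, queue (iter n (lab_iter E) (lab_init E)) = [::].
  by exists (iter n (lab_iter E) (lab_init E)); split=> //; exists n.
have [m] := ubnP (lab_measure (iter 0 (lab_iter E) (lab_init E))).
elim: m (0) => // m IHm n.
have [|q0 lt_m] := eqVneq (queue (iter n (lab_iter E) (lab_init E))) [::]; first by exists n.
apply: (IHm n.+1); apply: leq_trans (lt_m : _ <= m).
by apply: lab_iter_measure; [case: (lab_iters_inv n)|exact/eqP].
Qed.

(** These properties characterise the distances along [succX] from N(y_1); from here on labels enter
    only through them. *)
Record lab_spec (L : {ffun 'I_nX -> label}) : Prop := LabSpec {
  lab_spec0 : forall x, (L x == Some 0) = (leftY E x == 1);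
  lab_specS : forall x n, L x = Some n.+1 -> exists2 z, succX E z x & L z = Some n;
  lab_spec_le : forall x z n, succX E x z -> L x = Some n ->
    exists2 m, L z = Some m & m <= n.+1 }.

(** With an empty queue [lab_closed] holds for all edges, which turns the upper bound of [lab_invS]
    into an equality. *)
Lemma labelling_spec s : labelling_ends_in E s -> lab_spec (Label s).
Proof.
case=> q0 [n def_s]; have := lab_iters_inv n; rewrite -def_s => -[[s0 sS _] clos].
have spec_le x z m : succX E x z -> Label s x = Some m ->
    exists2 k, Label s z = Some k & k <= m.+1.
  move=> xz Lx; have := clos x z; rewrite q0 Lx => /(_ isT xz).
  by case: (Label s z) => //= k; exists k.
split=> //.
  move=> x; rewrite s0 (mem_nbrsY E_convex E_nonempty).
  by have := leftY_gt0 E_nonempty x; have := leftY_le_rightY E_nonempty x; lia.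
move=> x m Lx; have [z zx le_z] := sS _ _ Lx; exists z => //.
have := spec_le _ _ _ zx; case: (Label s z) le_z => //= k km /(_ _ erefl)[j].
by rewrite Lx => -[<-] ?; congr Some; lia.
Qed.

End Labelling.

(** * Red dominating sets and paths *)

Section Domination.

Variables (nX nY : nat) (E : bigraph nX nY).
Hypotheses (E_convex : convex E) (E_nonempty : forall x, exists y, E x y).
Hypothesis E_lex : lex_convex E.

Implicit Types (x y z t : 'I_nX) (q r : seq 'I_nX) (D : {set 'I_nX}).

Let nbrsYE x i : (x \in nbrsY E i) = (leftY E x <= i <= rightY E x) :=
  mem_nbrsY E_convex E_nonempty x i.

Lemma succX_path_sorted x q : path (succX E) x q -> sorted ltn (map val (x :: q)).
Proof. by rewrite sorted_map; apply: sub_path => a b /(succX_ltn E_lex). Qed.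

Lemma succX_path_uniq x q : path (succX E) x q -> uniq (x :: q).
Proof.
move/succX_path_sorted => sq; rewrite -(map_inj_uniq val_inj).
by apply: sorted_uniq sq; [exact: ltn_trans | exact: ltnn].
Qed.

(** A path increases in [X], so it is the sorted list of its vertices. *)
Lemma succX_path_eq x q z r : path (succX E) x q -> path (succX E) z r ->
  x :: q =i z :: r -> x :: q = z :: r.
Proof.
move=> /succX_path_sorted sq /succX_path_sorted sr /(eq_mem_map val) eq_qr.
apply: (inj_map val_inj).
by apply: irr_sorted_eq sq sr eq_qr; [exact: ltn_trans | exact: ltnn].
Qed.

Lemma red_dominatingP D :
  red_dominating E D <->
  (forall i, 0 < i <= nY -> exists2 x, x \in D & leftY E x <= i <= rightY E x).
Proof.
split=> [domD [|i] // iY | domD y].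
  have [x xD] := domD (Ordinal iY); exists x => //.
  by rewrite -nbrsYE (nbrsY_edge E x (Ordinal iY)).
have [|x xD] := domD y.+1; first exact: ltn_ord.
by rewrite -nbrsYE nbrsY_edge; exists x.
Qed.

(** Successive intervals leave no gap, so by induction on the path their union is the initial
    segment of [Y] up to the right end of the last one. *)
Lemma succX_path_dominating x q D :
  {subset x :: q <= D} -> leftY E x = 1 -> path (succX E) x q ->
  rightY E (last x q) = nY -> red_dominating E D.
Proof.
move=> qD lx; have cover : path (succX E) x q -> forall i,
    0 < i <= rightY E (last x q) -> exists2 z, z \in x :: q & leftY E z <= i <= rightY E z.
  elim/last_ind: {qD} q => [|q z IHq] /=.
    by move=> _ i; exists x; rewrite ?inE ?eqxx ?lx.
  rewrite rcons_path last_rcons => /andP[xq /and3P[_ lz _]] i /andP[i0 iz].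
  case: (leqP i (rightY E (last x q))) => ir; last first.
    exists z; first by rewrite inE mem_rcons mem_head orbT.
    by rewrite iz (leq_trans lz ir).
  have [|t tq it] := IHq xq i; first by rewrite i0.
  by exists t => //; move: tq; rewrite !inE mem_rcons inE => /orP[]->; rewrite ?orbT.
move=> xq rq; apply/red_dominatingP => i; have := cover xq i.
rewrite rq => coverY /coverY[z zq zi].
by exists z => //; exact: qD.
Qed.

(* Strong induction on leftY x: the vertex before leftY x is covered by some z,
   and the chain for z either already reaches rightY x or can be extended by x. *)
Lemma succX_path_to D x : red_dominating E D -> x \in D ->
  exists z q, [/\ {subset z :: q <= D}, leftY E z = 1, path (succX E) z q,
    leftY E (last z q) <= leftY E x & rightY E x <= rightY E (last z q)].
Proof.
move/red_dominatingP => domD.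
have [m] := ubnP (leftY E x); elim: m x => // m IHm x lxm xD.
have [lx|lx] := eqVneq (leftY E x) 1.
  by exists x, [::]; split=> // t; rewrite inE => /eqP->.
have lx0 := leftY_gt0 E_nonempty x; have lrx := leftY_le_rightY E_nonempty x.
have rxY := rightY_le E_nonempty x.
have [|z zD lrz] := domD (leftY E x).-1; first lia.
have [|t [q [qD lt tq lq rq]]] := IHm z _ zD; first lia.
case: (leqP (rightY E x) (rightY E (last t q))) => rx; first by exists t, q; split=> //; lia.
exists t, (rcons q x); rewrite last_rcons rcons_path tq; split=> //=.
  by move=> u; rewrite inE mem_rcons inE orbCA => /predU1P[->//|uq]; apply: qD; rewrite inE.
by rewrite /succX; lia.
Qed.

Lemma succX_path_within D : 0 < nY -> red_dominating E D ->
  exists z q, [/\ {subset z :: q <= D}, leftY E z = 1, path (succX E) z q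
    & rightY E (last z q) = nY].
Proof.
move=> Y0 domD; have [|x xD lrx] := (red_dominatingP D).1 domD nY; first by rewrite Y0 /=.
have [z [q [qD lz zq _ rq]]] := succX_path_to domD xD; exists z, q; split=> //.
by have := rightY_le E_nonempty (last z q); lia.
Qed.

Lemma card_path_set x q : path (succX E) x q -> #|[set z in x :: q]| = (size q).+1.
Proof. by move=> /succX_path_uniq/card_uniqP qn; rewrite cardsE qn. Qed.

(** * Labels as distances, MCRD sets as shortest paths *)

Section Labels.

Variable L : {ffun 'I_nX -> label}.
Hypothesis L_spec : lab_spec E L.

(** Since [leftY E x] is positive, no truncation occurs in [leftY E x - 1], and the interval tests
    of GENERATE are [succX] read backwards. *)
Lemma candidateE x z : candidate E L x z = succX E z x && (L z == lab_pred (L x)).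
Proof.
rewrite /candidate /succX; have := leftY_gt0 E_nonempty x.
case: (ltnP (leftY E z) (leftY E x)) => [/[dup] /(leftY_ltn E_lex)|] zx; last by lia.
by case: eqP => _; lia.
Qed.

Lemma succX_path_label x q : L x = Some 0 -> path (succX E) x q ->
  exists2 m, L (last x q) = Some m & m <= size q.
Proof.
move=> Lx; elim/last_ind: q => [|q z IHq]; first by exists 0.
rewrite rcons_path last_rcons size_rcons => /andP[/IHq[m Lm mq]].
by move=> /(lab_spec_le L_spec)/(_ Lm)[k Lk km]; exists k => //; lia.
Qed.

(** Labels rise by at most one per edge, so equality at the end forces a rise of exactly one at
    every edge. *)
Lemma succX_path_tight x q : L x = Some 0 -> path (succX E) x q ->
  L (last x q) = Some (size q) -> path (fun z t => candidate E L t z) x q.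
Proof.
move=> Lx; elim/last_ind: q => [|q z IHq] //.
rewrite !rcons_path last_rcons size_rcons => /andP[xq qz] Lz.
have [m Lm mq] := succX_path_label Lx xq.
have [k] := lab_spec_le L_spec qz Lm; rewrite Lz => -[<-] qm.
have mE : m = size q by lia.
by rewrite IHq -?mE ?candidateE ?qz ?Lz /= ?Lm ?mE ?eqxx.
Qed.

Lemma candidate_path_succX x q :
  path (fun z t => candidate E L t z) x q -> path (succX E) x q.
Proof. by apply: sub_path => a b; rewrite candidateE => /andP[]. Qed.

(** The reason why no call of GENERATE is fruitless. *)
Lemma candidate_exists x n : L x = Some n.+1 ->
  exists2 z, candidate E L x z & L z = Some n.
Proof.
move=> Lx; have [z zx Lz] := lab_specS L_spec Lx.
by exists z => //; rewrite candidateE zx Lz Lx /=.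
Qed.

Lemma candidate_path_exists x n : L x = Some n ->
  exists z q, [/\ L z = Some 0, path (fun z t => candidate E L t z) z q,
    last z q = x & size q = n].
Proof.
elim: n x => [|n IHn] x Lx; first by exists x, [::].
have [z zx /IHn[t [q [Lt tq qz qn]]]] := candidate_exists Lx.
by exists t, (rcons q x); rewrite rcons_path last_rcons size_rcons tq qz zx qn.
Qed.

Lemma last_label_le x n : x \in nbrsY E nY -> L x = Some n ->
  exists2 m, last_label E L = Some m & m <= n.
Proof.
rewrite /last_label; elim: (nbrsY E nY) => //= z s IHs; rewrite inE big_cons.
case/predU1P=> [<- ->|/IHs/[apply]-[m -> mn]]; rewrite /lab_min.
  case: (\big[_/_]_(_ <- _) _) => [k|] /=; last by exists n.
  by case: leqP => [_|kn]; [exists n | exists k => //; exact: ltnW].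
case: (L z) => [k|] /=; last by exists m.
by case: leqP => [km|_]; [exists k => //; exact: leq_trans mn | exists m].
Qed.

Lemma last_label_attained m : last_label E L = Some m ->
  exists2 x, x \in nbrsY E nY & L x = Some m.
Proof.
rewrite /last_label; elim: (nbrsY E nY) => [|z s IHs]; rewrite ?big_nil // big_cons /lab_min.
case: ifP => _ Lm; first by exists z; rewrite ?mem_head.
by have [x xs Lx] := IHs Lm; exists x; rewrite // inE xs orbT.
Qed.

(** [D] contains a path to N(y_nY); its last label is at most its number of edges, which is less
    than its number of vertices. *)
Lemma last_label_le_card D : 0 < nY -> red_dominating E D ->
  exists2 m, last_label E L = Some m & m < #|D|.
Proof.
move=> Y0 domD; have [z [q [qD lz zq rq]]] := succX_path_within Y0 domD.
have Lz : L z = Some 0 by apply/eqP; rewrite (lab_spec0 L_spec) lz.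
have [n Ln nq] := succX_path_label Lz zq.
have lastY : last z q \in nbrsY E nY.
  by rewrite nbrsYE; have := leftY_le_rightY E_nonempty (last z q); lia.
have [m Lm mn] := last_label_le lastY Ln; exists m => //.
apply: leq_trans (_ : (size q).+1 <= _); first lia.
by rewrite -(card_path_set zq); apply/subset_leq_card/subsetP => t; rewrite inE => /qD.
Qed.

(** For [m] = k - 1 these are the shortest paths from N(y_1) to N(y_nY), stated with [candidate]
    because GENERATE builds them that way. *)
Definition label_path m z q : Prop :=
  [/\ L z = Some 0, path (fun z t => candidate E L t z) z q,
      last z q \in nbrsY E nY, L (last z q) = Some m & size q = m].

Lemma label_path_MCRD m z q : 0 < nY -> last_label E L = Some m ->
  label_path m z q -> MCRD E [set x in z :: q].
Proof.
move=> Y0 Lm [Lz /candidate_path_succX zq lastY _ qm]; split.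
  apply: (@succX_path_dominating z q) => //.
  - by move=> t tq; rewrite inE.
  - by apply/eqP; rewrite -(lab_spec0 L_spec) Lz.
  by move: lastY; rewrite nbrsYE; have := rightY_le E_nonempty (last z q); lia.
move=> D /(last_label_le_card Y0)[k]; rewrite Lm => -[<-] mD.
by rewrite card_path_set // qm.
Qed.

(** By minimality [D] is the path that it contains. Its length is at least its last label, hence at
    least [m], and at most [m] because some label path of length [m] dominates; so the path is
    tight. *)
Lemma MCRD_label_path m D : 0 < nY -> last_label E L = Some m ->
  MCRD E D -> exists z q, label_path m z q /\ D = [set x in z :: q].
Proof.
move=> Y0 Lm [domD minD]; have [z [q [qD lz zq rq]]] := succX_path_within Y0 domD.
have DE : D = [set x in z :: q].
  apply/esym/eqP; rewrite eqEcard; apply/andP; split.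
    by apply/subsetP => t; rewrite inE => /qD.
  by apply: minD; apply: (@succX_path_dominating z q) => // t tq; rewrite inE.
exists z, q; split=> //.
have Lz : L z = Some 0 by apply/eqP; rewrite (lab_spec0 L_spec) lz.
have [n Ln nq] := succX_path_label Lz zq.
have lastY : last z q \in nbrsY E nY.
  by rewrite nbrsYE; have := leftY_le_rightY E_nonempty (last z q); lia.
have [k] := last_label_le lastY Ln; rewrite Lm => -[<-] mn.
have qm : size q <= m.
  have [x xY Lx] := last_label_attained Lm.
  have [t [r [Lt tr rx rm]]] := candidate_path_exists Lx.
  have tr_path : label_path m t r by split=> //; rewrite rx.
  have [domr _] := label_path_MCRD Y0 Lm tr_path.
  have := minD _ domr; rewrite DE !card_path_set ?rm ?ltnS //.
  exact: candidate_path_succX.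
have nE : n = size q by lia.
by split; rewrite ?Ln //; first (by apply: succX_path_tight; rewrite // Ln nE); try congr Some; lia.
Qed.

Lemma label_path_inj m z q t r : label_path m z q -> label_path m t r ->
  [set x in z :: q] = [set x in t :: r] -> z :: q = t :: r.
Proof.
move=> [_ /candidate_path_succX zq _ _ _] [_ /candidate_path_succX tr _ _ _] eq_qr.
by apply: succX_path_eq => // x; move/setP/(_ x): eq_qr; rewrite !inE.
Qed.

End Labels.

End Domination.

(** * Auxiliary facts on lists *)

Lemma uniq_flatten_map (T U : eqType) (f : T -> seq U) (s : seq T) :
  uniq s -> (forall x, x \in s -> uniq (f x)) ->
  (forall x y u, x \in s -> y \in s -> u \in f x -> u \in f y -> x = y) ->
  uniq (flatten [seq f x | x <- s]).
Proof.
elim: s => //= x s IHs /andP[xs us] uf f_inj; rewrite cat_uniq uf ?mem_head //=.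
rewrite IHs ?andbT //; first last.
- by move=> y z u ys zs; apply: f_inj; rewrite inE ?ys ?zs orbT.
- by move=> y ys; apply: uf; rewrite inE ys orbT.
apply/hasPn => u /flatten_mapP[y ys uy]; apply/negP => ux.
by move: xs; rewrite (f_inj x y u) ?ys ?mem_head // inE ys orbT.
Qed.

Lemma onth_drop (T : Type) (s : seq T) i x :
  onth s i = Some x -> drop i s = x :: drop i.+1 s.
Proof. by elim: s i => [|y s IHs] [|i] //=; [case=> ->; rewrite drop0 | exact: IHs]. Qed.

Lemma onth_dropN (T : Type) (s : seq T) i : onth s i = None -> drop i s = [::].
Proof. by elim: s i => [|y s IHs] [|i] //=; exact: IHs. Qed.

Lemma onth_mem (T : eqType) (s : seq T) i x : onth s i = Some x -> x \in s.
Proof. by move=> sx; apply: (mem_drop (n0 := i)); rewrite (onth_drop sx) mem_head. Qed.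

(** * Output times of an iterated step function *)

(* [fut] lists the outputs still to come and [pot] bounds the number of steps
   before the next one. *)
Section Runs.

Variables (S A : Type) (step : S -> S) (out halt : pred S) (val : S -> A).
Variables (inv : S -> Prop) (fut : S -> seq A) (pot : S -> nat) (b : nat).

Hypothesis inv_step : forall s, inv s -> inv (step s).
Hypothesis fut_halt : forall s, halt s -> fut s = [::].
Hypothesis fut_out : forall s, inv s -> out s -> fut s = val s :: fut (step s).
Hypothesis fut_idle : forall s, inv s -> ~~ out s -> fut s = fut (step s).
Hypothesis pot_idle :
  forall s, inv s -> ~~ halt s -> ~~ out s -> pot (step s) < pot s.
Hypothesis pot_le : forall s, inv s -> pot s <= b.

(** Shifting all times by one enlarges only the first gap, counted from time 0. *)
Lemma path_shift_times (c : nat) ts : path (fun t t' => t' - t <= c) 0 ts ->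
  head 0 ts < c -> path (fun t t' => t' - t <= c) 0 (map succn ts).
Proof. by case: ts => //= t ts /andP[_]; rewrite path_map => + ->. Qed.

(** The delay is [b.+1]: one step to leave an output state, then at most [b] steps by the
    potential. *)
Lemma run_outputs s : inv s -> exists T,
  let ts := [seq t <- iota 0 T | out (iter t step s)] in
  [/\ halt (iter T step s), [seq val (iter t step s) | t <- ts] = fut s
    & path (fun t t' => t' - t <= b.+1) 0 (rcons ts T)].
Proof.
(* The bound on the first time is added for the induction: it controls the gap that the shift
   enlarges. *)
move=> inv_s; suff [T [HT fT dT _]] : exists T,
    let ts := [seq t <- iota 0 T | out (iter t step s)] in
    [/\ halt (iter T step s), [seq val (iter t step s) | t <- ts] = fut s,
        path (fun t t' => t' - t <= b.+1) 0 (rcons ts T)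
      & head 0 (rcons ts T) <= pot s] by exists T.
(* An idle step lowers [pot]; an output shortens [fut], whose weight [b.+1] pays for any new value
   of [pot]. *)
have [m] := ubnP (size (fut s) * b.+1 + pot s); elim: m s inv_s => // m IHm s inv_s lt_m.
have [hs|nhs] := boolP (halt s); first by exists 0; rewrite /= fut_halt.
have iotaE T : [seq t <- iota 0 T.+1 | out (iter t step s)] =
    (if out s then [:: 0] else [::]) ++
    [seq t.+1 | t <- [seq t <- iota 0 T | out (iter t step (step s))]].
  rewrite /= -[1]addn0 iotaDl filter_map.
  have -> : [seq t <- iota 0 T | preim (addn 1) (fun t => out (iter t step s)) t] =
            [seq t <- iota 0 T | out (iter t step (step s))].
    by apply: eq_filter => t /=; rewrite -iterSr.
  by case: (out s).
have mapE ts : [seq val (iter t step s) | t <- [seq t.+1 | t <- ts]] =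
    [seq val (iter t step (step s)) | t <- ts].
  by rewrite -map_comp; apply: eq_map => t /=; rewrite -iterSr.
have pot1 := pot_le (inv_step inv_s).
have [os|nos] := boolP (out s).
- have [|T [HT fT dT hT]] := IHm (step s) (inv_step inv_s).
    by move: lt_m; rewrite fut_out //=; nia.
  exists T.+1; cbv zeta; rewrite iotaE os cat1s rcons_cons -map_rcons iterSr /= mapE fT -fut_out //.
  split=> //; apply: path_shift_times => //; lia.
have lt_pot := pot_idle inv_s nhs nos.
have [|T [HT fT dT hT]] := IHm (step s) (inv_step inv_s).
  by move: lt_m; rewrite fut_idle //=; lia.
exists T.+1; cbv zeta; rewrite iotaE (negbTE nos) cat0s -map_rcons iterSr /= mapE fT -fut_idle //.
have pot0 := pot_le inv_s.
split=> //; first by apply: path_shift_times => //; lia.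
by move: hT; case: (rcons _ _) => //= t ts; lia.
Qed.

End Runs.

(** * The lists produced by GENERATE *)

Section Enumeration.

Variables (nX nY : nat) (E : bigraph nX nY).
Hypotheses (E_convex : convex E) (E_nonempty : forall x, exists y, E x y).
Hypothesis E_lex : lex_convex E.
Variable L : {ffun 'I_nX -> label}.
Hypothesis L_spec : lab_spec E L.
Variable k1 : label.
(** Conditional on a neighbour of the last vertex: for [nX] = 0 and [nY] = 1 the graph is connected,
    yet k - 1 is infinite. *)
Hypothesis k1_finite : forall x : 'I_nX, x \in nbrsY E nY -> k1 <> None.

Implicit Types (x y z t : 'I_nX) (q D : seq 'I_nX) (st : seq ('I_nX * nat)).

Let nbrsYE x i : (x \in nbrsY E i) = (leftY E x <= i <= rightY E x) :=
  mem_nbrsY E_convex E_nonempty x i.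

Let succX_label x z : candidate E L x z = succX E z x && (L z == lab_pred (L x)) :=
  candidateE E_nonempty E_lex L x z.

Definition candidates x i : seq 'I_nX :=
  [seq z <- drop i (nbrsY E (leftY E x - 1)) | candidate E L x z].

(** The outputs of the call on the set [x :: D] and the vertex [x], in order; the label [n] of [x]
    is the recursion depth. *)
Fixpoint gen n x D : seq (seq 'I_nX) :=
  if n is m.+1 then flatten [seq gen m z (x :: D) | z <- candidates x 0]
  else [:: x :: D].

Lemma candidate_nbrsY x z : candidate E L x z -> z \in nbrsY E (leftY E x - 1).
Proof. by case/and4P=> _ lz _ _; rewrite nbrsYE. Qed.

Lemma mem_candidates x z : (z \in candidates x 0) = candidate E L x z.
Proof.
rewrite mem_filter drop0; case: (boolP (candidate _ _ _ _)) => //= /candidate_nbrsY->.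
by [].
Qed.

Lemma candidate_label x z n : L x = Some n.+1 -> candidate E L x z -> L z = Some n.
Proof. by move=> Lx; rewrite succX_label Lx => /andP[_ /eqP]. Qed.

Lemma nbrsY_uniq i : uniq (nbrsY E i).
Proof. by rewrite filter_uniq ?enum_uniq. Qed.

Lemma candidates_uniq x i : uniq (candidates x i).
Proof. by rewrite filter_uniq ?drop_uniq ?nbrsY_uniq. Qed.

Lemma gen_sound n x D D' : L x = Some n ->
  path (fun z t => candidate E L t z) x D -> D' \in gen n x D ->
  exists z q, [/\ D' = z :: q, L z = Some 0, path (fun z t => candidate E L t z) z q,
    last z q = last x D & size q = n + size D].
Proof.
elim: n x D => [|n IHn] x D Lx xD /=.
  by rewrite inE => /eqP->; exists x, D.
case/flatten_mapP=> z; rewrite mem_candidates => xz.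
case/(IHn _ _ (candidate_label Lx xz)) => [|t [q [-> Lt tq qz qn]]].
  by rewrite /= xz.
by exists t, q; split=> //; rewrite qn /= addnS.
Qed.

Lemma gen_complete z q D : path (fun z t => candidate E L t z) z q ->
  z :: q ++ D \in gen (size q) (last z q) D.
Proof.
elim/last_ind: q D => [|q t IHq] D; first by rewrite /= inE.
rewrite rcons_path last_rcons size_rcons cat_rcons => /andP[zq qt] /=.
by apply/flatten_mapP; exists (last z q); rewrite ?mem_candidates ?IHq.
Qed.

(** Vertices are only added in front. An output thus reveals the call it comes from, whence
    distinctness. *)
Lemma gen_drop n x D D' : D' \in gen n x D -> drop n D' = x :: D.
Proof.
elim: n x D => [|n IHn] x D /=; first by rewrite inE drop0 => /eqP.
by case/flatten_mapP=> z _ /IHn Dz; rewrite -add1n -drop_drop Dz.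
Qed.

Lemma gen_uniq n x D : uniq (gen n x D).
Proof.
elim: n x D => //= n IHn x D; apply: uniq_flatten_map => [||z t D' _ _].
- exact: candidates_uniq.
- by move=> z _; exact: IHn.
- by move=> /gen_drop Dz /gen_drop; rewrite Dz => -[].
Qed.

(** * Outputs still to come from a state of the machine *)

Definition gen_label x D := gen (odflt 0 (L x)) x D.

Definition fut_from x i D : seq (seq 'I_nX) :=
  flatten [seq gen_label z (x :: D) | z <- candidates x i].

(** The set of a pending call consists of its vertex and those below it on the stack, so the stack
    alone determines what remains. *)
Fixpoint fut_calls st : seq (seq 'I_nX) :=
  if st is (x, i) :: st' then fut_from x i (unzip1 st') ++ fut_calls st' else [::].

Definition fut_main p : seq (seq 'I_nX) :=
  flatten [seq gen_label x [::] | x <- [seq x <- drop p (nbrsY E nY) | L x == k1]].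

Definition future (s : enum_state nX) : seq (seq 'I_nX) :=
  let: EnumState c p st D := s in
  match c with
  | Loop => fut_calls st ++ fut_main p
  | Enter => if st is (x, _) :: st'
             then gen_label x (unzip1 st') ++ fut_calls st' ++ fut_main p
             else [::]
  | Print _ => D :: fut_calls (behead st) ++ fut_main p
  | Return => fut_calls (behead st) ++ fut_main p
  | Halt => [::]
  end.

Lemma gen_labelS x n D : L x = Some n.+1 -> gen_label x D = fut_from x 0 D.
Proof.
move=> Lx; rewrite /gen_label /fut_from Lx /=; congr flatten.
by apply/eq_in_map => z; rewrite mem_candidates /gen_label => /(candidate_label Lx) ->.
Qed.

(** Being a path, [dom] has at most [nX] vertices, and left ends increase down the stack; finiteness
    lets [gen_label] read actual labels. *)
Record enum_inv (s : enum_state nX) : Prop := EnumInv {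
  enum_inv_dom : dom s = unzip1 (calls s);
  enum_inv_sorted : sorted (succX E) (dom s);
  enum_inv_label : forall x, x \in dom s -> L x <> None;
  enum_inv_ctl : match ctl s with
                 | Enter => if calls s is (_, i) :: _ then i = 0 else False
                 | Print i => i <= size (dom s)
                 | _ => True
                 end }.

Lemma enum_inv_step s : enum_inv s -> enum_inv (enum_step E L k1 s).
Proof.
case: s => c p st D [/= defD sD labD ctlD]; case: c ctlD => [||i||] ctlD //=.
- by case: st defD ctlD => [|[x i] st] //= defD _; case: ifP => _; split.
- case: st defD => [|[x i] st] /= defD.
    case: onth (@onth_mem _ (nbrsY E nY) p) => [x|] /= x_nbr; last by split.
    case: eqP => [Lx|_]; split=> // t; rewrite inE => /eqP->.
    by rewrite Lx; exact: k1_finite (x_nbr _ erefl).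
  case: onth => [z|] /=; last by split.
  case: ifP => // xz.
  move: xz; rewrite succX_label => /andP[zx /eqP Lz]; split=> [|||//] /=; first by rewrite defD.
    by move: sD; rewrite defD /= zx.
  move=> t; rewrite inE => /predU1P[->|/labD//]; rewrite Lz.
  by have := labD x; rewrite defD mem_head => /(_ isT); case: (L x).
- by case: ltnP => ?; split.
- split=> [|||//] /=; first by rewrite defD; case: (st).
    by case: D sD {defD labD} => //= x D /path_sorted.
  by move=> x /mem_behead; exact: labD.
Qed.

Lemma future_out s : enum_inv s -> outputting s ->
  future s = dom s :: future (enum_step E L k1 s).
Proof. by case: s => -[||i||] //= p st D _ /eqP->; rewrite ltnn. Qed.

Lemma future_idle s : enum_inv s -> ~~ outputting s ->
  future s = future (enum_step E L k1 s).
Proof.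
case: s => -[||i||] p st D [//= defD sD labD ctlD] => nout.
- case: st defD ctlD => [|[x i] st] //= defD ->.
  have := labD x; rewrite defD mem_head => /(_ isT).
  case Lx: (L x) => [[|n]|] // _ /=; first by rewrite /gen_label Lx.
  by rewrite (gen_labelS _ Lx) catA.
- case: st defD => [|[x i] st] /= defD.
    rewrite /fut_main; case def_x: onth => [x|]; last by rewrite (onth_dropN def_x).
    by rewrite (onth_drop def_x) /=; case: eqP.
  rewrite /fut_from /candidates; case def_z: onth => [z|] /=; last by rewrite (onth_dropN def_z).
  by rewrite (onth_drop def_z) /=; case: ifP => //= _; rewrite /fut_from /candidates !catA.
- by rewrite ltn_neqAle ctlD andbT; move: nout => /= ->.
Qed.

(** * A potential bounding the steps before the next output *)

Definition deg i := size (nbrsY E i).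

(** Steps set aside for the lists N(y_i) with [i < m]: each scan, plus a constant for the other
    steps of its call. The call of [x] is charged to the index [leftY E x - 1]. *)
Definition reserve m := \sum_(i < m) (deg i + 3).

Lemma reserve_le m n : m <= n -> reserve m <= reserve n.
Proof.
by move/subnKC <-; rewrite /reserve big_split_ord leq_addr.
Qed.

Lemma reserve_leftY x :
  reserve (leftY E x) = reserve (leftY E x - 1) + (deg (leftY E x - 1) + 3).
Proof.
have := leftY_gt0 E_nonempty x; case: (leftY E x) => // m _.
by rewrite subn1 /reserve big_ord_recr.
Qed.

Lemma reserve_leftY_le x : reserve (leftY E x) <= reserve nY.+1.
Proof.
apply: reserve_le.
by have := leftY_le_rightY E_nonempty x; have := rightY_le E_nonempty x; lia.
Qed.

(** Steps to leave all pending calls when no candidate remains: for each, the rest of its scan, the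
    step that finds the list exhausted, and the return. *)
Fixpoint unwind st : nat :=
  if st is (x, i) :: st' then deg (leftY E x - 1) - i + 2 + unwind st' else 0.

(** Left ends increase strictly down the stack, so the pending calls are charged to distinct
    indices, none below [leftY E x - 1]. *)
Lemma unwind_le st x i : path (succX E) x (unzip1 st) ->
  unwind ((x, i) :: st) + reserve (leftY E x - 1) <= reserve nY.+1.
Proof.
elim: st x i => [|[y j] st IHst] x i /= => [_|/andP[xy yst]]; last have := IHst y j yst.
  by have := reserve_leftY_le x; rewrite reserve_leftY; lia.
have /reserve_le : leftY E x <= leftY E y - 1 by case/and3P: xy; lia.
by rewrite reserve_leftY /=; lia.
Qed.

(** The rest of the scan of N(y_nY), one full descent, the printing of at most [nX] vertices, and a
    constant. *)
Definition pot_main p : nat := deg nY - p + reserve nY.+1 + nX + 4.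

(* In the call of x either a candidate remains, and then the next output is
   reached by going down only, so that the calls made have smaller and smaller
   left ends; or none remains, and then the run goes up until it finds one. *)
Definition potential (s : enum_state nX) : nat :=
  let: EnumState c p st D := s in
  match c with
  | Loop => if st is (x, i) :: st' then
              if candidates x i is [::] then unwind st + pot_main p
              else reserve (leftY E x - 1) + (deg (leftY E x - 1) - i) + nX + 3
            else pot_main p
  | Enter => if st is (x, _) :: _ then reserve (leftY E x) + nX + 2 else 0
  | Print i => nX + 1 - i
  | Return => unwind (behead st) + pot_main p + 1
  | Halt => 0
  end.

Lemma enum_inv_size s : enum_inv s -> size (dom s) <= nX.
Proof.
case=> _ sD _ _; have := card_size (dom s); have := max_card (mem (dom s)).
rewrite card_ord; suff /card_uniqP -> : uniq (dom s) by [].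
by case: (dom s) sD => // x q; exact: succX_path_uniq.
Qed.

(** [pot_main] contains a full reserve, so the ascending case dominates; a return may therefore land
    in either case. *)
Lemma potential_loop_le x i st p D :
  potential (EnumState Loop p ((x, i) :: st) D) <= unwind ((x, i) :: st) + pot_main p.
Proof.
rewrite /=; case: (candidates x i) => // _ _; rewrite /pot_main.
by have := reserve_leftY_le x; rewrite reserve_leftY; lia.
Qed.

Lemma potential_idle s : enum_inv s -> ~~ halted s -> ~~ outputting s ->
  potential (enum_step E L k1 s) < potential s.
Proof.
move=> inv_s; have szD := enum_inv_size inv_s.
case: s inv_s szD => -[||i||] p st D [/= defD sD labD ctlD] szD //.
- case: st defD ctlD => [|[x i] st] //= defD -> _ _.
  have := labD x; rewrite defD mem_head => /(_ isT).
  case Lx: (L x) => [[|n]|] // _ /=; first by lia.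
  (* A positive label guarantees a candidate, so [Loop] starts in its descending case. *)
  have [z xz _] := candidate_exists E_nonempty E_lex L_spec Lx.
  move: xz; rewrite -mem_candidates; case: (candidates x 0) => // _ _ _.
  by rewrite reserve_leftY; lia.
- case: st defD => [|[x i] st] /= defD _ _.
    case def_x: onth => [x|]; last by rewrite /= /pot_main; lia.
    case: eqP => _ /=; rewrite /pot_main.
      by have := reserve_leftY_le x; lia.
    have : p < deg nY by rewrite /deg -onthTE def_x.
    by lia.
  case def_z: onth => [z|]; last first.
    by rewrite /candidates (onth_dropN def_z) /= /pot_main; lia.
  have lt_i : i < deg (leftY E x - 1) by rewrite /deg -onthTE def_z.
  rewrite /candidates (onth_drop def_z) /= -/(candidates x i.+1).
  case: ifP => [|_] /=.
    (* Going down: [z] starts to the left of [x], so its reserve fits into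
       [reserve (leftY E x - 1)]. *)
    rewrite succX_label => /andP[/and3P[zx _ _] _].
    have /reserve_le : leftY E z <= leftY E x - 1 by lia.
    lia.
  (* A rejected vertex leaves the same candidates, so the same case of the potential applies one
     position further. *)
  by case: (candidates x i.+1) => [|_ _]; lia.
- move=> _ /= iD; have lt_iD : i < size D by rewrite ltn_neqAle iD.
  by rewrite lt_iD /=; move: szD => /=; lia.
- move=> _ _; case: (st) => [|a [|[y j] st1]] /=; rewrite ?addn1 // ltnS.
  exact: (potential_loop_le y j st1 p (behead D)).
Qed.

Lemma deg_le i : deg i <= nX.
Proof. by rewrite /deg size_filter (leq_trans (count_size _ _)) // size_enum_ord. Qed.

(** One ascent and one descent cost a full reserve each; one [nX] pays for scanning N(y_nY), the
    other for printing. *)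
Definition delay_bound := 2 * reserve nY.+1 + 2 * nX + 5.

Lemma potential_le s : enum_inv s -> potential s <= delay_bound.
Proof.
move=> inv_s; have main_le p : pot_main p <= reserve nY.+1 + 2 * nX + 4.
  by rewrite /pot_main; have := deg_le nY; lia.
have unwind_sorted st : sorted (succX E) (unzip1 st) -> unwind st <= reserve nY.+1.
  by case: st => // -[x i] st sx; have := @unwind_le st x i sx; lia.
rewrite /delay_bound.
case: s inv_s => -[||i||] p st D [/= defD sD labD ctlD] //=; try lia.
- by case: st {defD ctlD} => [|[x i] st] //; have := reserve_leftY_le x; lia.
- case: st defD => [|[x i] st] defD; first by have := main_le p; lia.
  apply: leq_trans (potential_loop_le x i st p D) _.
  by have := main_le p; have := unwind_sorted ((x, i) :: st); rewrite -defD => /(_ sD); lia.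
- have := main_le p; have := unwind_sorted (behead st); rewrite /unzip1 -behead_map -[map _ st]defD.
  have sD' : sorted (succX E) (behead D) by case: D sD {defD labD} => //= x D /path_sorted.
  by move/(_ sD'); lia.
Qed.

(** The degrees in [Y] sum to |E|, and the list of index 0 is empty. *)
Lemma reserve_edges : reserve nY.+1 <= edges E + 3 * nY.+1.
Proof.
rewrite /reserve big_split /= sum_nat_const card_ord mulnC leq_add2r.
rewrite big_ord_recl /= {1}/deg.
have -> : size (nbrsY E 0) = 0.
  rewrite size_filter; apply/eqP; rewrite -leqn0 leqNgt -has_count.
  by apply/hasPn => x _; apply/existsP => -[].
rewrite add0n /edges -sum1dep_card -(pair_big_dep xpredT E (fun _ _ => 1)) /=.
rewrite (exchange_big_dep xpredT) //=; apply: leq_sum => y _.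
rewrite /deg -sum1_size big_filter big_enum_cond /=.
apply: eq_leq; apply: eq_bigl => x; rewrite -nbrsY_edge mem_filter mem_enum andbT.
by rewrite /bump leq0n.
Qed.

(** * Space, delay and outputs of the whole run *)

Lemma enum_run_inv (t : nat) : enum_inv (enum_run E L k1 t).
Proof. by elim: t => // t IHt; exact: enum_inv_step. Qed.

(** [calls] and [dom] have equal length, at most [nX], whence a total of at most 6 [nX] with the
    three arrays. *)
Lemma enum_space (t : nat) : space E (enum_run E L k1 t) <= 6 * gsize E + 4.
Proof.
have inv_t := enum_run_inv t; have szD := enum_inv_size inv_t.
have szC : size (calls (enum_run E L k1 t)) = size (dom (enum_run E L k1 t)).
  by rewrite (enum_inv_dom inv_t) size_map.
by rewrite /space szC /gsize; lia.
Qed.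

Lemma enum_outputs : exists T,
  [/\ halted (enum_run E L k1 T),
      outputs E L k1 T = [seq [set x in D] | D <- fut_main 0]
    & delay_le (output_times E L k1 T) T (12 * gsize E + 12)].
Proof.
have fut_halt s : halted s -> future s = [::] by case: s => -[].
have [T [HT fT dT]] := run_outputs (val := @dom nX) enum_inv_step fut_halt
  future_out future_idle potential_idle potential_le (enum_run_inv 0).
exists T; split=> //; first by rewrite -[fut_main 0]fT -map_comp.
apply: sub_path dT => t t' /leq_trans; apply.
(* By [reserve_edges], [delay_bound.+1] is at most 2|E| + 6 [nY] + 2 [nX] + 12. *)
by have := reserve_edges; rewrite /delay_bound /gsize; lia.
Qed.

Lemma fut_main0_P m D : k1 = Some m -> D \in fut_main 0 <->
  exists z q, D = z :: q /\ label_path E L m z q.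
Proof.
move=> k1E; split=> [/flatten_mapP[x]|[z [q [-> [Lz zq lastY Lq qm]]]]].
  rewrite mem_filter drop0 k1E => /andP[/eqP Lx xY]; rewrite /gen_label Lx.
  case/(gen_sound Lx) => // z [q [-> Lz zq qx qm]]; exists z, q; split=> //.
  by split=> //; rewrite ?qx // qm addn0.
apply/flatten_mapP; exists (last z q).
  by rewrite mem_filter drop0 lastY Lq k1E eqxx.
by rewrite /gen_label Lq -qm -[q in z :: q]cats0; exact: gen_complete.
Qed.

Lemma fut_main0_uniq : uniq (fut_main 0).
Proof.
apply: uniq_flatten_map => [||x y D].
- by rewrite drop0 filter_uniq ?nbrsY_uniq.
- by move=> x _; exact: gen_uniq.
rewrite !mem_filter => /andP[/eqP Lx _] /andP[/eqP Ly _].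
by rewrite /gen_label Lx Ly => /gen_drop Dx /gen_drop; rewrite Dx => -[].
Qed.

End Enumeration.

(** * Enumeration of the MCRD sets in linear space with linear delay *)

Theorem theorem5 :
  exists c : nat, forall (nX nY : nat) (E : bigraph nX nY),
    0 < nY -> connected E -> convex E -> lex_convex E ->
    (exists s : lab_state nX, labelling_ends_in E s) /\
    forall s : lab_state nX, labelling_ends_in E s ->
      let k1 := last_label E (Label s) in
      exists T : nat,
        [/\ halted (enum_run E (Label s) k1 T),
            uniq (outputs E (Label s) k1 T),
            forall D : {set 'I_nX},
              D \in outputs E (Label s) k1 T <-> MCRD E D,
            forall t : nat,
              space E (enum_run E (Label s) k1 t) <= c * gsize E
          & delay_le (output_times E (Label s) k1 T) T (c * gsize E)].
Proof.
(* 24 = 12 + 12: the additive constant of the delay is absorbed because [gsize E] is positive. *)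
exists 24 => nX nY E Y0 E_conn E_convex E_lex.
have E_nonempty x : exists y, E x y.
  have /connectP[[|[z|y] p] //= /andP[xy _] _] := E_conn (inl x) (inr (Ordinal Y0)).
  by exists y.
split=> [|s /(labelling_spec E_convex E_nonempty E_lex) L_spec k1].
  exact: labelling_terminates.
have gsize_gt0 : 0 < gsize E by rewrite /gsize; lia.
(* Given a vertex of [X], connectedness makes all of [X] dominating, so [last_label_le_card]
   applies. *)
have k1_some (x : 'I_nX) : exists m, k1 = Some m.
  suff domT : red_dominating E [set: 'I_nX].
    by have [m Lm _] := last_label_le_card E_convex E_nonempty E_lex L_spec Y0 domT; exists m.
  move=> y; have /connectP[[|[z|y'] p] //= /andP[zy _] _] := E_conn (inr y) (inl x).
  by exists z; rewrite ?inE.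
have k1_spec x : x \in nbrsY E nY -> k1 <> None by move=> _; have [m ->] := k1_some x.
have [T [HT outT dT]] := enum_outputs E_convex E_nonempty E_lex L_spec k1_spec.
have space_le t : space E (enum_run E (Label s) k1 t) <= 24 * gsize E.
  by apply: leq_trans (enum_space E_nonempty E_lex (Label s) k1_spec t) _; lia.
have delay_T : delay_le (output_times E (Label s) k1 T) T (24 * gsize E).
  by apply: sub_path dT => t u tu; apply: leq_trans tu _; lia.
have futP m D := @fut_main0_P _ _ E E_convex E_nonempty E_lex (Label s) k1 m D.
exists T; rewrite outT; split=> // [|D].
  (* The lists are distinct, and so are their sets, because a path is determined by its vertices. *)
  rewrite map_inj_in_uniq; first exact: fut_main0_uniq.
  move=> D D' D_fut D'_fut; have [x _ _] := flatten_mapP D_fut; have [m k1E] := k1_some x.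
  have [z [q [-> zq]]] := (futP m D k1E).1 D_fut.
  have [z' [q' [-> zq']]] := (futP m D' k1E).1 D'_fut.
  exact: label_path_inj zq zq'.
split=> [/mapP[D' D'_fut ->]|D_min].
  have [x _ _] := flatten_mapP D'_fut; have [m k1E] := k1_some x.
  have [z [q [-> zq]]] := (futP m D' k1E).1 D'_fut.
  exact: label_path_MCRD zq.
have [x _ _] := D_min.1 (Ordinal Y0); have [m k1E] := k1_some x.
have [z [q [zq ->]]] := MCRD_label_path E_convex E_nonempty E_lex L_spec Y0 k1E D_min.
apply: (map_f (fun D : seq 'I_nX => [set x in D])).
by apply/(futP m _ k1E); exists z, q.
Qed.
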